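(* The canonical morphisms of monoids $\mathbb{B}_W^+\longrightarrow\mathbb{B}_W$ and $\mathbb{B}_W^-\longrightarrow\mathbb{B}_W$ are injective.
   Context: $\Gamma$ is a connected Dynkin diagram of type ADE with vertex set $I$, and $W$ is its Weyl group. $\mathbb{B}_W$ is the group with generators $\sigma_i$ ($i\in I$) and relations $\sigma_i\sigma_j\sigma_i=\sigma_j\sigma_i\sigma_j$ if $i,j$ are adjacent in $\Gamma$, $\sigma_i\sigma_j=\sigma_j\sigma_i$ otherwise. $\mathbb{B}_W^+$ is the monoid defined by the same generators and relations (as a monoid presentation), and $\mathbb{B}_W^-$ is the monoid with generators $\sigma_i^{-1}$ ($i\in I$, regarded as formal symbols) subject to the same braid and commutation relations. The canonical morphisms send each generator to the element of $\mathbb{B}_W$ of the same name. *)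

(* Defs.v *)
From HB Require Import structures.
From mathcomp Require Import all_boot.
From mathcomp Require Import boolp.

Set Implicit Arguments.
Unset Strict Implicit.
Unset Printing Implicit Defensive.

Local Open Scope group_scope.
Local Open Scope quotient_scope.

Section PresentedMonoid.
Variables (S : choiceType) (R : seq S -> seq S -> Prop).

Inductive pres_cong : seq S -> seq S -> Prop :=
| pres_cong_step u v l r : R l r -> pres_cong (u ++ l ++ v) (u ++ r ++ v)
| pres_cong_refl w : pres_cong w w
| pres_cong_sym w1 w2 : pres_cong w1 w2 -> pres_cong w2 w1
| pres_cong_trans w1 w2 w3 :
    pres_cong w1 w2 -> pres_cong w2 w3 -> pres_cong w1 w3.

Lemma pres_cong_ctx u v w1 w2 :
  pres_cong w1 w2 -> pres_cong (u ++ w1 ++ v) (u ++ w2 ++ v).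
Proof.
elim=> {w1 w2} [a b l r Rlr|w|w1 w2 _ IH|w1 w2 w3 _ IH1 _ IH2].
- by have := pres_cong_step (u ++ a) (b ++ v) Rlr; rewrite -!catA.
- exact: pres_cong_refl.
- exact: pres_cong_sym.
- exact: pres_cong_trans IH1 IH2.
Qed.

Lemma pres_cong_cat u1 u2 v1 v2 :
  pres_cong u1 u2 -> pres_cong v1 v2 -> pres_cong (u1 ++ v1) (u2 ++ v2).
Proof.
move=> /(pres_cong_ctx [::] v1) /= uP /(pres_cong_ctx u2 [::]).
by rewrite !cats0; apply: pres_cong_trans uP.
Qed.

Definition pres_congb : rel (seq S) := fun w1 w2 => `[< pres_cong w1 w2 >].

Lemma pres_congb_refl : reflexive pres_congb.
Proof. by move=> w; apply/asboolP/pres_cong_refl. Qed.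

Lemma pres_congb_sym : symmetric pres_congb.
Proof. by move=> v w; apply/asboolP/asboolP; apply: pres_cong_sym. Qed.

Lemma pres_congb_trans : transitive pres_congb.
Proof.
move=> v u w /asboolP uv /asboolP vw; apply/asboolP.
exact: pres_cong_trans uv vw.
Qed.

Canonical pres_equiv :=
  EquivRel pres_congb pres_congb_refl pres_congb_sym pres_congb_trans.

Definition pres_monoid := {eq_quot pres_equiv}.

HB.instance Definition _ := Choice.on pres_monoid.
HB.instance Definition _ := EqQuotient.on pres_monoid.

Definition pres_class (w : seq S) : pres_monoid := \pi_pres_monoid w.

Definition pres_gen (s : S) : pres_monoid := pres_class [:: s].

Lemma pres_classP (w1 w2 : seq S) :
  pres_class w1 = pres_class w2 <-> pres_cong w1 w2.
Proof. by split=> [/eqmodP/asboolP|?]; last by apply/eqmodP/asboolP. Qed.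

Lemma pres_class_rel l r : R l r -> pres_class l = pres_class r.
Proof.
move=> Rlr; apply/pres_classP.
by have := pres_cong_step [::] [::] Rlr; rewrite /= !cats0.
Qed.

Lemma pres_class_repr (x : pres_monoid) : pres_class (repr x) = x.
Proof. exact: reprK. Qed.

Definition pres_one : pres_monoid := pres_class [::].

Definition pres_mul (x y : pres_monoid) : pres_monoid :=
  pres_class (repr x ++ repr y).

Lemma pres_mulE w1 w2 :
  pres_mul (pres_class w1) (pres_class w2) = pres_class (w1 ++ w2).
Proof.
by apply/pres_classP/pres_cong_cat; apply/pres_classP/pres_class_repr.
Qed.

Lemma pres_mulA : associative pres_mul.
Proof.
move=> x y z; rewrite -(pres_class_repr x) -(pres_class_repr y).
by rewrite -(pres_class_repr z) !pres_mulE catA.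
Qed.

Lemma pres_mul1 : left_id pres_one pres_mul.
Proof. by move=> x; rewrite -(pres_class_repr x) pres_mulE. Qed.

Lemma pres_mulr1 : right_id pres_one pres_mul.
Proof. by move=> x; rewrite -(pres_class_repr x) pres_mulE cats0. Qed.

HB.instance Definition _ :=
  isMonoid.Build pres_monoid pres_mulA pres_mul1 pres_mulr1.

Lemma pres_class_cat w1 w2 :
  pres_class (w1 ++ w2) = pres_class w1 * pres_class w2.
Proof. by rewrite [RHS]pres_mulE. Qed.

Lemma pres_classE w : pres_class w = \prod_(s <- w) pres_gen s.
Proof.
elim: w => [|s w IH]; first by rewrite big_nil.
by rewrite big_cons -IH -pres_class_cat.
Qed.

(* The extension of f to a monoid morphism; it is well defined, i.e.
   independent of the representative, when f respects R. *)
Definition pres_lift (M : monoidType) (f : S -> M) (x : pres_monoid) : M :=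
  \prod_(s <- repr x) f s.

Section Lift.
Variables (M : monoidType) (f : S -> M).
Hypothesis fR : forall l r, R l r -> \prod_(s <- l) f s = \prod_(s <- r) f s.

Lemma pres_lift_class w : pres_lift f (pres_class w) = \prod_(s <- w) f s.
Proof.
have: pres_cong (repr (pres_class w)) w by apply/pres_classP/pres_class_repr.
rewrite /pres_lift; move: (repr _) => w'.
elim=> // {w w'}[u v l r /fR lr|w1 w2 w3 _ -> _ ->//].
by rewrite !big_cat /= lr.
Qed.

Lemma pres_lift_gen s : pres_lift f (pres_gen s) = f s.
Proof. by rewrite pres_lift_class big_seq1. Qed.

Lemma pres_lift_morphism : monoid_morphism (pres_lift f).
Proof.
split=> [|x y]; first by rewrite (pres_lift_class [::]) big_nil.
rewrite -(pres_class_repr x) -(pres_class_repr y) -pres_class_cat.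
by rewrite !pres_lift_class big_cat.
Qed.

End Lift.
End PresentedMonoid.

(* The letter (s, true) stands for s and (s, false) for its inverse. *)
Section PresentedGroup.
Variables (S : choiceType) (R : seq (S * bool) -> seq (S * bool) -> Prop).

Inductive group_rel : seq (S * bool) -> seq (S * bool) -> Prop :=
| group_rel_base l r : R l r -> group_rel l r
| group_rel_cancel s b : group_rel [:: (s, b); (s, ~~ b)] [::].

Definition pres_group := pres_monoid group_rel.

HB.instance Definition _ := Monoid.on pres_group.

Definition inv_letter (a : S * bool) : S * bool := (a.1, ~~ a.2).

Definition inv_word (w : seq (S * bool)) := rev (map inv_letter w).

Definition pres_inv (x : pres_group) : pres_group :=
  pres_class group_rel (inv_word (repr x)).

Lemma inv_wordK : involutive inv_word.
Proof.
move=> w; rewrite /inv_word map_rev revK -map_comp map_id_in // => -[s b] _.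
by rewrite /= /inv_letter /= negbK.
Qed.

Lemma mul_inv_word w :
  pres_class group_rel w * pres_class group_rel (inv_word w) = 1.
Proof.
rewrite -pres_class_cat; apply/pres_classP.
elim: w => [|[s b] w IH]; first exact: pres_cong_refl.
have /= := pres_cong_ctx [:: (s, b)] [:: (s, ~~ b)] IH.
rewrite /inv_word /= rev_cons -cats1 -catA => /pres_cong_trans; apply.
exact: (pres_cong_step [::] [::] (group_rel_cancel s b)).
Qed.

Lemma pres_mulV : right_inverse 1 pres_inv (@mul pres_group).
Proof.
by move=> x; rewrite -{1}(pres_class_repr x); apply: mul_inv_word.
Qed.

Lemma pres_mulVl : left_inverse 1 pres_inv (@mul pres_group).
Proof.
move=> x; rewrite -{2}(pres_class_repr x) /pres_inv.
by rewrite -{2}(inv_wordK (repr x)); apply: mul_inv_word.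
Qed.

HB.instance Definition _ := hasInv.Build pres_group pres_inv.
HB.instance Definition _ := Monoid_isGroup.Build pres_group pres_mulVl pres_mulV.

Definition group_gen (s : S) : pres_group := pres_gen group_rel (s, true).

End PresentedGroup.

(* DynE n is meant for n = 6, 7, 8 only. *)
Inductive ade_type := DynA of nat | DynD of nat | DynE of nat.

Definition ade_valid (t : ade_type) : bool :=
  match t with
  | DynA n => (1 <= n)%N
  | DynD n => (4 <= n)%N
  | DynE n => (6 <= n <= 8)%N
  end.

Definition ade_rank (t : ade_type) : nat :=
  match t with DynA n | DynD n | DynE n => n end.

(* Edges i -- j with i < j.  In types D and E, the vertices 0, ..., n - 2 form
   a path and the last vertex n - 1 is attached to the vertex n - 3 of the path
   in type D (arms of lengths n - 3, 1, 1), and to its vertex 2 in type E (arms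
   of lengths 2, n - 4, 1). *)
Definition ade_edge (t : ade_type) (i j : nat) : bool :=
  match t with
  | DynA n => j == i.+1
  | DynD n => (j == i.+1) && (j < n.-1)%N || (i == n - 3)%N && (j == n.-1)
  | DynE n => (j == i.+1) && (j < n.-1)%N || (i == 2) && (j == n.-1)
  end.

Definition ade_adj (t : ade_type) (i j : nat) : bool :=
  ade_edge t i j || ade_edge t j i.

(* The graph (I, adj) is isomorphic to a diagram A_n, D_n, E_6, E_7 or E_8. *)
Definition ADE_diagram (I : finType) (adj : rel I) : Prop :=
  exists t : ade_type, ade_valid t /\
  exists f : 'I_(ade_rank t) -> I,
    bijective f /\ forall i j, adj (f i) (f j) = ade_adj t i j.

(* The braid and commutation relations between the letters f i. *)
Inductive braid_rel (I : finType) (adj : rel I) (T : Type) (f : I -> T) :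
  seq T -> seq T -> Prop :=
| braid_rel_adj i j : adj i j ->
    braid_rel adj f [:: f i; f j; f i] [:: f j; f i; f j]
| braid_rel_comm i j : ~~ adj i j ->
    braid_rel adj f [:: f i; f j] [:: f j; f i].

(* The formal symbols sigma_i^{-1}. *)
Variant formal_inv (I : Type) := FormalInv of I.

Definition formal_inv_val I (s : formal_inv I) := let: FormalInv i := s in i.

Lemma formal_inv_valK I : cancel (@formal_inv_val I) (@FormalInv I).
Proof. by case. Qed.

HB.instance Definition _ (I : choiceType) :=
  Choice.copy (formal_inv I) (can_type (@formal_inv_valK I)).

Section Braid.
Variables (I : finType) (adj : rel I).

Definition braid_group := pres_group (braid_rel adj (fun i : I => (i, true))).
Definition braid_monoid_pos := pres_monoid (braid_rel adj (fun i : I => i)).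
Definition braid_monoid_neg := pres_monoid (braid_rel adj (@FormalInv I)).

HB.instance Definition _ := Group.on braid_group.
HB.instance Definition _ := Monoid.on braid_monoid_pos.
HB.instance Definition _ := Monoid.on braid_monoid_neg.

Definition sigma (i : I) : braid_group := group_gen _ i.
Definition sigma_pos (i : I) : braid_monoid_pos := pres_gen _ i.
Definition sigma_neg (i : I) : braid_monoid_neg := pres_gen _ (FormalInv i).

Definition braid_pos_can : braid_monoid_pos -> braid_group := pres_lift sigma.

Definition braid_neg_can : braid_monoid_neg -> braid_group :=
  pres_lift (fun s => (sigma (formal_inv_val s))^-1).

Lemma sigma_braid i j :
  adj i j -> sigma i * (sigma j * sigma i) = sigma j * (sigma i * sigma j).
Proof.
move=> /(braid_rel_adj (fun i : I => (i, true)))/group_rel_base/pres_class_rel.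
by rewrite !pres_classE !big_cons !big_nil !mulg1.
Qed.

Lemma sigma_comm i j : ~~ adj i j -> sigma i * sigma j = sigma j * sigma i.
Proof.
move=> /(braid_rel_comm (fun i : I => (i, true)))/group_rel_base/pres_class_rel.
by rewrite !pres_classE !big_cons !big_nil !mulg1.
Qed.

Lemma sigma_pos_rel l r : braid_rel adj (fun i : I => i) l r ->
  \prod_(i <- l) sigma i = \prod_(i <- r) sigma i.
Proof.
case=> i j aij; rewrite !big_cons !big_nil !mulg1.
- exact: sigma_braid.
- exact: sigma_comm.
Qed.

Lemma sigma_neg_rel l r : braid_rel adj (@FormalInv I) l r ->
  \prod_(s <- l) (sigma (formal_inv_val s))^-1 =
  \prod_(s <- r) (sigma (formal_inv_val s))^-1.
Proof.
case=> i j aij; rewrite !big_cons !big_nil !mulg1 /= -!invgM; congr _^-1.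
- by rewrite -!mulgA (sigma_braid aij).
- by rewrite (sigma_comm aij).
Qed.

HB.instance Definition _ :=
  isUMagmaMorphism.Build braid_monoid_pos braid_group braid_pos_can
    (pres_lift_morphism sigma_pos_rel).

HB.instance Definition _ :=
  isUMagmaMorphism.Build braid_monoid_neg braid_group braid_neg_can
    (pres_lift_morphism sigma_neg_rel).

Lemma braid_pos_can_gen i : braid_pos_can (sigma_pos i) = sigma i.
Proof. exact: pres_lift_gen sigma_pos_rel i. Qed.

Lemma braid_neg_can_gen i : braid_neg_can (sigma_neg i) = (sigma i)^-1.
Proof. exact: pres_lift_gen sigma_neg_rel (FormalInv i). Qed.

End Braid.

(* Main.v *)
(* The monoid M of positive braids is left cancellative by Garside's lemma: if
   s x = t y for generators s and t, then both sides are multiples of the least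
   common multiple of s and t.  Moreover M contains a central element D that is
   divisible by every generator: the square of a product of Jucys-Murphy-like
   elements in types A and D, and a power of a Coxeter element in type E.  Hence
   M embeds in its localization at D, where the generators are invertible, and
   words that are equal in the braid group are equal in this localization. *)

Require Import Defs.
From mathcomp Require Import all_boot zify.

Set Implicit Arguments.
Unset Strict Implicit.
Unset Printing Implicit Defensive.

Local Open Scope group_scope.

(** * Garside's lemma and left cancellation for positive braids *)

Section Cancellation.
Variables (I : finType) (adj : rel I).
Hypotheses (adj_irr : irreflexive adj) (adj_sym : symmetric adj).
Hypothesis triangle_free :
  forall r s t, adj s r -> adj r t -> adj s t = false.

Let M := braid_monoid_pos adj.
Let g : I -> M := sigma_pos adj.
Let cls (w : seq I) : M := pres_class _ w.

Lemma pos_class_cons s w : cls (s :: w) = g s * cls w.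
Proof. exact: (pres_class_cat _ [:: s] w). Qed.

(** The trailing factor [x] allows rewriting inside right-nested products. *)
Lemma sigma_pos_braid i j (x : M) :
  adj i j -> g i * (g j * (g i * x)) = g j * (g i * (g j * x)).
Proof.
move=> /(braid_rel_adj (fun i : I => i))/pres_class_rel.
rewrite !pres_classE !big_cons !big_nil !mulg1 => e.
by have := congr1 (mul^~ x) e; rewrite /= -!mulgA.
Qed.

Lemma sigma_pos_comm i j (x : M) :
  ~~ adj i j -> g i * (g j * x) = g j * (g i * x).
Proof.
move=> /(braid_rel_comm (fun i : I => i))/pres_class_rel.
rewrite !pres_classE !big_cons !big_nil !mulg1 => e.
by have := congr1 (mul^~ x) e; rewrite /= -!mulgA.
Qed.

(** The relations preserve length, so every representative gives the same value. *)
Definition pos_len (x : M) : nat := size (repr x).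

Lemma pos_len_class w : pos_len (cls w) = size w.
Proof.
have: pres_cong (braid_rel adj (fun i => i)) (repr (cls w)) w.
  by apply/pres_classP/pres_class_repr.
rewrite /pos_len; move: (repr _) => w'.
elim=> // {w w'} [u v l r R|w1 w2 w3 _ -> _ ->//].
by rewrite !size_cat; case: R.
Qed.

Lemma pos_lenS s x : pos_len (g s * x) = (pos_len x).+1.
Proof.
rewrite -(pres_class_repr x) -/(cls _) -pos_class_cons.
by rewrite !pos_len_class.
Qed.

(* The conclusion of Garside's lemma for s x = t y: both sides are multiples of
   the least common multiple of s and t. *)
Definition lcm_factor s t (x y : M) : Prop :=
  if s == t then x = y
  else if adj s t then exists z, x = g t * (g s * z) /\ y = g s * (g t * z)
  else exists z, x = g t * z /\ y = g s * z.

Lemma lcm_factor_sym s t x y : lcm_factor s t x y -> lcm_factor t s y x.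
Proof.
rewrite /lcm_factor eq_sym adj_sym.
by case: ifP => // _; case: ifP => _ [z [-> ->]]; exists z.
Qed.

Section Step.
Variable n : nat.
Hypothesis IH : forall s t x y,
  pos_len x < n -> g s * x = g t * y -> lcm_factor s t x y.

Lemma cancel_below s x y : pos_len x < n -> g s * x = g s * y -> x = y.
Proof. by move=> lx /(IH lx); rewrite /lcm_factor eqxx. Qed.

Lemma comm_below s t x y : s != t -> ~~ adj s t -> pos_len x < n ->
  g s * x = g t * y -> exists z, x = g t * z /\ y = g s * z.
Proof.
by move=> /negPf nst /negPf nadj lx /(IH lx); rewrite /lcm_factor nst nadj.
Qed.

Lemma braid_below s t x y : s != t -> adj s t -> pos_len x < n ->
  g s * x = g t * y ->
  exists z, x = g t * (g s * z) /\ y = g s * (g t * z).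
Proof.
by move=> /negPf nst adjst lx /(IH lx); rewrite /lcm_factor nst adjst.
Qed.

(** Here [z = s r A = t B], and [IH], applied to shorter equations, splits off letters until the
    witness appears. Either [r - s - t] is a path, or [t] commutes with both [s] and [r]. *)
Lemma lcm_factor_trans_adj s r t x y z : s != r -> r != t -> s != t ->
  adj s r -> ~~ adj r t -> pos_len z = n ->
  lcm_factor s r x z -> lcm_factor r t z y -> lcm_factor s t x y.
Proof.
move=> nsr nrt nst asr nart lz; rewrite /lcm_factor.
rewrite (negPf nsr) (negPf nrt) (negPf nst) asr (negPf nart).
move=> [A [-> zE]] [B [zE' ->]].
have lA : (pos_len A).+2 = n by rewrite -lz zE !pos_lenS.
have ltA : pos_len A < n by rewrite -lA ltnS leqnSn.
have ltrA : pos_len (g r * A) < n by rewrite pos_lenS -lA.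
have e : g s * (g r * A) = g t * B by rewrite -zE.
have ars : adj r s by rewrite adj_sym.
have natr : ~~ adj t r by rewrite adj_sym.
case: ifP => [ast|/negbT nast].
- have ats : adj t s by rewrite adj_sym.
  case/braid_below: e => [|||C [rA ->]] //.
  case/comm_below: (rA) => [|||D [AE sC]] //.
  case/braid_below: (sC) => [|||F [-> DE]] //.
    apply: ltn_trans ltA.
    by have := congr1 pos_len rA; rewrite !pos_lenS => -[->].
  exists (g r * (g s * (g t * F))); rewrite AE DE; split.
  + rewrite (sigma_pos_braid (i := s) (j := t)) //.
    rewrite (sigma_pos_comm (i := r) (j := t)) //; congr (_ * _).
    by rewrite (sigma_pos_comm (i := t)) // (sigma_pos_braid (i := r)).
  + rewrite (sigma_pos_comm (i := t)) // (sigma_pos_braid (i := r)) //.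
    rewrite (sigma_pos_braid (i := s) (j := t)) //.
    by rewrite (sigma_pos_comm (i := r)).
- case/comm_below: e => [|||C [rA ->]] //.
  case/comm_below: rA => [|||D [-> ->]] //.
  exists (g r * (g s * D)).
  rewrite (sigma_pos_comm (i := s)) // (sigma_pos_comm (i := r)) //.
  by rewrite (sigma_pos_braid (i := r)).
Qed.

Lemma lcm_factor_trans_comm s r t x y z : s != r -> r != t -> s != t ->
  ~~ adj s r -> ~~ adj r t -> pos_len z = n ->
  lcm_factor s r x z -> lcm_factor r t z y -> lcm_factor s t x y.
Proof.
move=> nsr nrt nst nasr nart lz; rewrite /lcm_factor.
rewrite (negPf nsr) (negPf nrt) (negPf nst) (negPf nasr) (negPf nart).
move=> [A [-> zE]] [B [zE' ->]].
have lA : (pos_len A).+1 = n by rewrite -lz zE pos_lenS.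
have ltA : pos_len A < n by rewrite -lA.
have e : g s * A = g t * B by rewrite -zE.
have nars : ~~ adj r s by rewrite adj_sym.
case: ifP => [ast|/negbT nast].
- case/braid_below: e => [|||C [-> ->]] //.
  exists (g r * C).
  rewrite !(sigma_pos_comm (i := r) (j := t)) //.
  rewrite !(sigma_pos_comm (i := r) (j := s)) //.
  by rewrite (sigma_pos_comm (i := r) (j := t)).
- case/comm_below: e => [|||C [-> ->]] //.
  by exists (g r * C); rewrite !(sigma_pos_comm (i := r)).
Qed.

Lemma lcm_factor_trans_path s r t x y z : s != r -> r != t -> s != t ->
  adj s r -> adj r t -> pos_len z = n ->
  lcm_factor s r x z -> lcm_factor r t z y -> lcm_factor s t x y.
Proof.
move=> nsr nrt nst asr art lz; rewrite /lcm_factor.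
rewrite (negPf nsr) (negPf nrt) (negPf nst) asr art (triangle_free asr art).
move=> [A [-> zE]] [B [zE' ->]].
have nast : ~~ adj s t by rewrite (triangle_free asr art).
have nats : ~~ adj t s by rewrite adj_sym.
have ars : adj r s by rewrite adj_sym.
have atr : adj t r by rewrite adj_sym.
have lA : (pos_len A).+2 = n by rewrite -lz zE !pos_lenS.
have ltA : pos_len A < n by rewrite -lA ltnS leqnSn.
have ltrA : pos_len (g r * A) < n by rewrite pos_lenS -lA.
have e : g s * (g r * A) = g t * (g r * B) by rewrite -zE.
case/comm_below: e => [|||C [rA rB]] //.
case/braid_below: (rA) => [|||D [AE CE]] //.
case/braid_below: (rB) => [|||F [BE CE']] //; rewrite 1?eq_sym //.
  have := congr1 pos_len rB; rewrite !pos_lenS => -[->].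
  by have := congr1 pos_len rA; rewrite !pos_lenS => -[<-].
(* [C] equals both [r t D] and [r s F]; the common [r] cancels at a smaller length. *)
have tsE : g t * D = g s * F.
  apply: (@cancel_below r); last by rewrite -CE.
  by rewrite -lA AE !pos_lenS !ltnS leqW.
case/comm_below: (tsE) => [|||G [DE FE]] //; rewrite 1?eq_sym //.
  by rewrite -lA AE !pos_lenS ltnS !leqW.
exists (g r * (g t * (g s * (g r * G)))); rewrite AE BE DE FE; split.
- rewrite (sigma_pos_comm (i := s) (j := t)) // (sigma_pos_braid (i := s)) //.
  by rewrite (sigma_pos_braid (i := r) (j := t)).
- rewrite (sigma_pos_comm (i := t) (j := s)) // (sigma_pos_braid (i := t)) //.
  rewrite (sigma_pos_braid (i := r) (j := s)) //.
  by rewrite (sigma_pos_comm (i := s) (j := t)).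
Qed.

Lemma lcm_factor_trans s r t x y z : pos_len x = n -> pos_len z = n ->
  pos_len y = n ->
  lcm_factor s r x z -> lcm_factor r t z y -> lcm_factor s t x y.
Proof.
move=> lx lz ly.
have [<-|nsr] := eqVneq s r; first by rewrite {1}/lcm_factor eqxx => ->.
have [<-|nrt] := eqVneq r t; first by rewrite {2}/lcm_factor eqxx => ? <-.
(* For [s = t] both hypotheses factor [z], and cancellation at smaller lengths identifies the
   cofactors [A] and [B]. *)
have [<-|nst] := eqVneq s t.
  rewrite /lcm_factor eqxx (eq_sym r) (adj_sym r) (negPf nsr).
  case: ifP => asr [A [-> zE]] [B [zE' ->]]; move: zE; rewrite zE' => e.
  - suff -> : A = B by [].
    apply: (@cancel_below r); first by rewrite -lz zE' e !pos_lenS.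
    apply: (@cancel_below s); first by rewrite -lz zE' e !pos_lenS.
    by rewrite e.
  - suff -> : A = B by [].
    by apply: (@cancel_below s); rewrite ?e // -lz zE' e !pos_lenS.
case asr: (adj s r); case art: (adj r t).
- exact: lcm_factor_trans_path.
- by apply: lcm_factor_trans_adj => //; rewrite art.
(* Reading [s, r, t] backwards gives the preceding case. *)
- move=> /lcm_factor_sym sr /lcm_factor_sym rt; apply: lcm_factor_sym.
  apply: (lcm_factor_trans_adj _ _ _ _ _ lz rt sr); rewrite 1?eq_sym //.
    by rewrite adj_sym.
  by rewrite adj_sym asr.
- by apply: lcm_factor_trans_comm => //; rewrite ?asr ?art.
Qed.

End Step.

(* Garside's lemma, by induction on the length of x and, at a given length, on
   the derivation of s x = t y; lcm_factor_trans handles transitivity. *)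
Lemma lcm_factorP s t x y : g s * x = g t * y -> lcm_factor s t x y.
Proof.
have [n] := ubnP (pos_len x); elim: n s t x y => // n IH.
(* Transitivity needs the hypothesis at the exact length of the tail, hence a bound [m] below
   [n]. *)
have {}IH m s t x y : m <= n -> pos_len x < m -> g s * x = g t * y ->
    lcm_factor s t x y.
  by move=> mn lx; apply: IH; apply: leq_trans lx mn.
(* The intermediate words of a derivation may start with any letter, so the claim speaks of words
   split into first letter and tail. *)
suff class_factor w1 w2 : pres_cong (braid_rel adj (fun i => i)) w1 w2 ->
    size w1 <= n.+1 ->
    match w1, w2 with
    | s :: u, t :: v => lcm_factor s t (cls u) (cls v)
    | _, _ => True
    end.
  move=> s t x y lx; rewrite -(pres_class_repr x) -(pres_class_repr y).
  rewrite -!/(cls _) -!pos_class_cons => /pres_classP /class_factor /=.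
  exact.
elim=> {w1 w2}
  [[|s u] v l r R|[|s w]|w1 w2 ww IHw|w1 w2 w3 w12 IH12 w23 IH23] //=.
(* A relation applied at the front exhibits the common multiple itself, with the rest [v] as
   witness. *)
- case: R => i j aij _ /=; rewrite /lcm_factor.
    case: eqP => [ij|_]; first by rewrite ij adj_irr in aij.
    by rewrite aij; exists (cls v); rewrite !pos_class_cons.
  case: eqP => [->//|_].
  by rewrite (negPf aij); exists (cls v); rewrite !pos_class_cons.
- move=> _; rewrite /lcm_factor eqxx.
  by apply/pres_classP; apply: pres_cong_step.
- by move=> _; rewrite /lcm_factor eqxx.
- have sz : size w1 = size w2.
    by rewrite -!pos_len_class; congr pos_len; apply/pres_classP.
  rewrite -sz => /IHw; case: (w1) (w2) => [|s u] [|t v] //.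
  exact: lcm_factor_sym.
- have sz12 : size w1 = size w2.
    by rewrite -!pos_len_class; congr pos_len; apply/pres_classP.
  have sz23 : size w2 = size w3.
    by rewrite -!pos_len_class; congr pos_len; apply/pres_classP.
  move=> sz1; move: (sz1); rewrite sz12 => /IH23; move: (sz1) => /IH12.
  case: w1 w2 w3 sz12 sz23 sz1 {w12 IH12 w23 IH23} =>
    [|s u] [|t v] [|r w] //= [suv] [svw] lu.
  apply: (@lcm_factor_trans (size u)); rewrite ?pos_len_class -?svw //.
  by move=> ? ? ? ? lx; apply: IH lx.
Qed.

Lemma sigma_pos_cancel s : injective (mul (g s)).
Proof. by move=> x y /lcm_factorP; rewrite /lcm_factor eqxx. Qed.

Lemma pos_cancel (z : M) : injective (mul z).
Proof.
move=> x y; rewrite -(pres_class_repr z).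
elim: (repr z) => [|s w IH]; first by rewrite !mul1g.
rewrite -/(cls _) pos_class_cons -!mulgA => /sigma_pos_cancel.
exact: IH.
Qed.

End Cancellation.

(** * Central elements for a chain ending in a fork: types A and D *)

Section Chain.
Variables (M : monoidType) (a b : M) (v : nat -> M) (m : nat).
Hypotheses (ab_comm : a * b = b * a)
  (av_braid : 0 < m -> a * (v 0 * a) = v 0 * (a * v 0))
  (bv_braid : 0 < m -> b * (v 0 * b) = v 0 * (b * v 0))
  (av_comm : forall i, 0 < i < m -> commute a (v i))
  (bv_comm : forall i, 0 < i < m -> commute b (v i))
  (vv_braid : forall i, i.+1 < m ->
    v i * (v i.+1 * v i) = v i.+1 * (v i * v i.+1))
  (vv_comm : forall i j, i.+1 < j < m -> commute (v i) (v j)).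

(* In type A, where a = b, these are the Jucys-Murphy elements. *)
Fixpoint chain_jm k := if k is k.+1 then v k * (chain_jm k * v k) else a * b.

(** In type D this is the Garside element, in type A its square, the full twist. *)
Fixpoint chain_delta k :=
  if k is k.+1 then chain_delta k * chain_jm k.+1 else a * b.

Lemma chain_jmS k : chain_jm k.+1 = v k * (chain_jm k * v k).
Proof. by []. Qed.

Lemma chain_deltaS k : chain_delta k.+1 = chain_delta k * chain_jm k.+1.
Proof. by []. Qed.

Lemma chain_jm_above k j : k < j < m -> commute (v j) (chain_jm k).
Proof.
elim: k => [|k IH] kjm /=.
  by apply: commuteM; apply: commute_sym; [apply: av_comm|apply: bv_comm].
have vkj : commute (v j) (v k) by apply/commute_sym/vv_comm; lia.
by do 2?apply: commuteM => //; apply: IH; lia.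
Qed.

Lemma chain_delta_above k j : k < j < m -> commute (v j) (chain_delta k).
Proof.
elim: k => [|k IH] kjm; first exact: (chain_jm_above (k := 0)).
by apply: commuteM; [apply: IH; lia|apply: chain_jm_above].
Qed.

(** With [v = v 0], [a v a b v = v a v b v = v a b v b]; the later letters commute with [a] and
    [b]. *)
Lemma chain_jm_fork k : k < m ->
  a * chain_jm k.+1 = chain_jm k.+1 * b /\
  b * chain_jm k.+1 = chain_jm k.+1 * a.
Proof.
elim: k => [|k IH] km.
  rewrite /=; split.
    transitivity (a * (v 0 * a) * (b * v 0)); first by rewrite !mulgA.
    by rewrite av_braid // -!mulgA -bv_braid.
  transitivity (b * (v 0 * b) * (a * v 0)); first by rewrite ab_comm !mulgA.
  by rewrite bv_braid // -!mulgA -av_braid // (mulgA b a) -ab_comm !mulgA.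
have [|aE bE] := IH; first by lia.
have av : commute a (v k.+1) by apply: av_comm.
have bv : commute b (v k.+1) by apply: bv_comm.
rewrite (chain_jmS k.+1); split.
- by rewrite mulgA av -mulgA (mulgA a) aE -!mulgA bv.
- by rewrite mulgA bv -mulgA (mulgA b) bE -!mulgA av.
Qed.

Lemma chain_jm_below k j : j.+1 < k <= m -> commute (v j) (chain_jm k).
Proof.
elim: k => // k IH jkm.
have [jk|kj] := ltnP j.+1 k.
  have vjk : commute (v j) (v k) by apply: vv_comm; lia.
  by do 2?apply: commuteM => //; apply: IH; lia.
have -> : k = j.+1 by lia.
have jm : j.+1 < m by lia.
have vc : commute (v j.+1) (chain_jm j) by apply: chain_jm_above; lia.
(* One braid relation turns [v j] into [v j.+1], which passes [c]; another turns it back. *)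
rewrite /commute /=; set c := chain_jm j in vc *.
transitivity (v j * (v j.+1 * v j) * (c * (v j * v j.+1))).
  by rewrite !mulgA.
rewrite vv_braid // -!mulgA; congr (_ * (_ * _)).
by rewrite (mulgA _ c) vc -!mulgA -vv_braid.
Qed.

Lemma chain_jm_comm i k : i < k <= m -> commute (chain_jm i) (chain_jm k).
Proof.
elim: i => [|i IH] ik /=.
  (* Passing [chain_jm k.+1] exchanges [a] and [b], which preserves [a * b]. *)
  case: k ik => // k km; have [//|aE bE] := chain_jm_fork (k := k).
  by rewrite /commute -mulgA bE mulgA aE -!mulgA ab_comm.
have vk : commute (chain_jm k) (v i) by apply/commute_sym/chain_jm_below.
apply: commute_sym; do 2?apply: commuteM => //.
by apply/commute_sym/IH; lia.
Qed.

Lemma chain_delta_jm i k : i < k <= m -> commute (chain_delta i) (chain_jm k).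
Proof.
elim: i => [|i IH] ik; first exact: (chain_jm_comm (i := 0)).
apply: commute_sym; apply: commuteM; apply: commute_sym.
  by apply: IH; lia.
exact: chain_jm_comm.
Qed.

Lemma chain_delta_gen j k : j < k <= m -> commute (v j) (chain_delta k).
Proof.
elim: k => // k IH jkm.
have [jk|kj] := ltnP j k.
  by apply: commuteM; [apply: IH; lia|apply: chain_jm_below; lia].
have -> : k = j by lia.
have jm : j < m by lia.
have jm_comm : commute (chain_jm j) (v j * (chain_jm j * v j)).
  by apply: (chain_jm_comm (i := j) (k := j.+1)); lia.
(* With [c = chain_jm j] and [v = v j], [jm_comm] reads [c v c v = v c v c]. Hence [v] commutes with
   [c (v c v)], the product of the last two factors of [chain_delta j.+1]. *)
have vjm : v j * (chain_jm j * (v j * (chain_jm j * v j))) =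
           chain_jm j * (v j * (chain_jm j * (v j * v j))).
  by move: (congr1 (mul^~ (v j)) jm_comm) => /=; rewrite -!mulgA.
case: {kj jkm IH jm_comm} j jm vjm => [|j] jm vjm.
  by move: vjm; rewrite /commute /= -!mulgA.
have vd : commute (v j.+1) (chain_delta j) by apply: chain_delta_above; lia.
rewrite /commute !chain_deltaS (chain_jmS j.+1).
move: (chain_jm j.+1) vjm => c vjm; rewrite -!mulgA.
by rewrite (mulgA (v _) (chain_delta j)) vd -!mulgA vjm.
Qed.

(** Every factor after [a * b] exchanges [a] and [b], so the parity of [k] decides between the
    alternatives. *)
Lemma chain_delta_fork k : k <= m ->
  exists x y, [/\ a * chain_delta k = chain_delta k * x,
    b * chain_delta k = chain_delta k * y &
    (x = a /\ y = b) \/ (x = b /\ y = a)].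
Proof.
elim: k => [|k IH] km.
  exists a, b; split; last by left.
    by rewrite /= -mulgA -ab_comm.
  by rewrite /= mulgA -ab_comm.
have [|aE bE] := chain_jm_fork (k := k); first by lia.
have [|x [y [xE yE xy]]] := IH; first by lia.
rewrite chain_deltaS; move: (chain_jm k.+1) aE bE => c aE bE.
rewrite !mulgA xE yE -!mulgA.
case: xy => [] [-> ->].
  by exists b, a; split; [rewrite aE mulgA|rewrite bE mulgA|right].
by exists a, b; split; [rewrite bE mulgA|rewrite aE mulgA|left].
Qed.

Lemma chain_delta_div j k : j < k <= m -> exists d, chain_delta k = v j * d.
Proof.
elim: k => // k IH jkm.
have [jk|kj] := ltnP j k.
  have [|d dE] := IH; first by lia.
  by exists (d * chain_jm k.+1); rewrite mulgA -dE.
have -> : k = j by lia.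
(* The last factor begins with [v j] and commutes past [chain_delta j]. *)
exists (chain_jm j * v j * chain_delta j).
rewrite chain_deltaS chain_delta_jm; last by lia.
by rewrite chain_jmS -(mulgA (v j)).
Qed.

(** Squaring [chain_delta m] undoes its possible exchange of [a] and [b]. *)
Lemma chain_central : exists D : M,
  [/\ commute a D, commute b D & forall j, j < m -> commute (v j) D] /\
  [/\ exists d, D = a * d, exists d, D = b * d &
      forall j, j < m -> exists d, D = v j * d].
Proof.
exists (chain_delta m * chain_delta m); split; split.
- have [x [y [aE bE [] [? ?]]]] := chain_delta_fork (leqnn m); subst x y;
    by rewrite /commute mulgA aE -mulgA ?aE ?bE mulgA.
- have [x [y [aE bE [] [? ?]]]] := chain_delta_fork (leqnn m); subst x y;
    by rewrite /commute mulgA bE -mulgA ?aE ?bE mulgA.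
- by move=> j jm; apply: commuteM; apply: chain_delta_gen; lia.
- suff [d ->] : exists d, chain_delta m = a * d.
    by exists (d * (a * d)); rewrite -(mulgA a).
  elim: (m) => [|k [d dE]]; first by exists b.
  by exists (d * chain_jm k.+1); rewrite mulgA -dE.
- suff [d ->] : exists d, chain_delta m = b * d.
    by exists (d * (b * d)); rewrite -(mulgA b).
  elim: (m) => [|k [d dE]]; first by exists a.
  by exists (d * chain_jm k.+1); rewrite mulgA -dE.
- move=> j jm; have [|d dE] := chain_delta_div (j := j) (k := m); first by lia.
  by exists (d * chain_delta m); rewrite mulgA -dE.
Qed.

End Chain.

(** * Checking centrality of a word by computation, for type E *)

Section MoveToFront.
Variables (adj : nat -> nat -> bool) (M : monoidType) (h : nat -> M).
Hypotheses
  (h_braid : forall i j, adj i j -> h i * (h j * h i) = h j * (h i * h j))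
  (h_comm : forall i j, ~~ adj i j -> commute (h i) (h j)).

(* A word w' with s w' = w, found by moving a letter s to the front of w; the
   first argument bounds the length of w. *)
Fixpoint extract n s w : option (seq nat) :=
  if n is n.+1 then
    if w is t :: w then
      if s == t then Some w
      else if extract n s w is Some w1 then
        if adj s t then omap (fun z => [:: t, s & z]) (extract n t w1)
        else Some (t :: w1)
      else None
    else None
  else None.

Fixpoint extract_all n u w : option (seq nat) :=
  if u is s :: u then obind (extract_all n u) (extract n s w) else Some w.

Let val (w : seq nat) : M := \prod_(s <- w) h s.

(** Uses [t s t z = s t s z] for adjacent letters and [t s z = s t z] otherwise. Soundness suffices:
    a failed extraction only makes the test fail. *)
Lemma extractP n s w w' : extract n s w = Some w' -> val w = h s * val w'.
Proof.
elim: n s w w' => // n IH s [|t w] w' //=.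
case: eqP => [<- [<-]|_]; first by rewrite /val big_cons.
case E: (extract n s w) => [w1|//]; move/IH in E.
case: ifP => [ast|/negbT nast].
  case F: (extract n t w1) => [z|//] [<-]; move/IH in F.
  move: E F; rewrite /val !big_cons => -> ->.
  by rewrite (mulgA (h s)) (mulgA (h t)) -h_braid // -!mulgA.
case=> <-; move: E; rewrite /val !big_cons => ->.
by rewrite !mulgA (h_comm nast).
Qed.

Lemma extract_allP n u w w' :
  extract_all n u w = Some w' -> val w = val u * val w'.
Proof.
elim: u w => [w [->]|s u IH w] /=; first by rewrite /val big_nil mul1g.
case E: (extract n s w) => [w1|//] /= /IH w1E.
by rewrite (extractP E) w1E /val big_cons mulgA.
Qed.

(** The equality [s w = w s] is tested by stripping the letters of [s w] from the front of [w s]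
    until nothing remains. *)
Definition central_word n (w : seq nat) : bool :=
  all (fun s => isSome (extract (size w).+1 s w) &&
         (extract_all (size w).+2 (s :: w) (rcons w s) == Some [::]))
      (iota 0 n).

Lemma central_wordP n w : central_word n w ->
  exists D : M, forall s, s < n -> commute (h s) D /\ exists d, D = h s * d.
Proof.
move=> /allP wP; exists (val w) => s sn.
have /wP /andP[] : s \in iota 0 n by rewrite mem_iota.
case E: (extract _ s w) => [w'|//] _ /eqP /extract_allP wsE.
split; last by exists (val w'); apply: extractP E.
by move: wsE; rewrite /commute /val big_rcons big_cons big_nil /= mulg1 => <-.
Qed.

End MoveToFront.

(* The word is a power of a Coxeter element c, namely c^h in type E6 and c^(h/2)
   in types E7 and E8, where h = 12, 18, 30 is the Coxeter number. *)
Lemma central_word_E n : 6 <= n <= 8 ->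
  central_word (ade_adj (DynE n)) n
    (flatten (nseq (nth 0 [:: 12; 9; 15] (n - 6)) (iota 0 n))).
Proof.
by case: n => [|[|[|[|[|[|[|[|[|]]]]]]]]] //= _; vm_compute.
Qed.

(** * Injectivity from cancellation and a central common multiple *)

Section Embedding.
Variables (I : finType) (adj : rel I).

Let M := braid_monoid_pos adj.
Let g : I -> M := sigma_pos adj.

(* A word in the generators and their inverses has the value N w / D ^ n w in
   the localization of M at D, where the inverse of s is d s / D. *)
Lemma braid_pos_can_inj (D : M) :
  (forall z : M, injective (mul z)) ->
  (forall s, commute (g s) D) -> (forall s, exists d, D = g s * d) ->
  injective (@braid_pos_can I adj).
Proof.
move=> Mcancel gD /fin_all_exists[d dE].
have cD x : commute x D.
  rewrite -(pres_class_repr x) pres_classE; apply/commute_sym.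
  by apply: commute_prod => s _; apply/commute_sym/gD.
have dgE s : D = d s * g s.
  by apply: (Mcancel (g s)); rewrite mulgA -dE gD.
pose N w := \prod_(a <- w) (if a.2 then g a.1 else d a.1).
pose n (w : seq (I * bool)) := count (fun a => ~~ a.2) w.
have cDX k x : x * D ^+ k = D ^+ k * x by apply: commuteX; apply: cD.
(* Equality of the fractions [N w / D ^ n w], with denominators cleared. *)
have valE w1 w2 :
    pres_cong (group_rel (braid_rel adj (fun i : I => (i, true)))) w1 w2 ->
    D ^+ n w2 * N w1 = D ^+ n w1 * N w2.
  have shuffle k x (u v : seq (I * bool)) :
      D ^+ (n u + (k + n v)) * (N u * (x * N v)) =
      D ^+ (n u + n v) * (N u * (D ^+ k * x * N v)).
    rewrite addnCA [(k + _)%N]addnC expgnDr -mulgA; congr (_ * _).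
    by rewrite mulgA -(cDX k (N u)) -!mulgA.
  elim=> {w1 w2} [u v l r R|//|w1 w2 _ ->//|w1 w2 w3 _ IH12 _ IH23].
    have lrE : D ^+ n r * N l = D ^+ n l * N r.
      case: R => [{}l {}r|s b]; last first.
        rewrite /n /N !big_cons !big_nil /= negbK.
        by case: b; rewrite /= expg0 expg1 mul1g !mulg1.
      case=> i j aij; rewrite /n /N !big_cons !big_nil /= !mul1g !mulg1.
        have /pres_class_rel := braid_rel_adj (fun i : I => i) aij.
        by rewrite !pres_classE !big_cons !big_nil !mulg1.
      have /pres_class_rel := braid_rel_comm (fun i : I => i) aij.
      by rewrite !pres_classE !big_cons !big_nil !mulg1.
    rewrite /n /N !count_cat !big_cat /= -!/(N _) -!/(n _).
    by rewrite !shuffle lrE.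
  (* Transitivity for fractions: the middle denominator is cancelled. *)
  apply: (Mcancel (D ^+ n w2)).
  rewrite mulgA -expgnDr addnC expgnDr -mulgA IH12 mulgA -expgnDr addnC.
  by rewrite expgnDr -mulgA IH23 !mulgA -!expgnDr addnC.
have canE w : braid_pos_can (pres_class _ w : M) =
              pres_class _ (map (fun s => (s, true)) w).
  rewrite /braid_pos_can (pres_lift_class (@sigma_pos_rel I adj)).
  by rewrite pres_classE big_map.
(* Positive words have denominator 1, so [valE] becomes an equality in [M]. *)
have n0 w : n (map (fun s => (s, true)) w) = 0 by elim: w.
have NE w : N (map (fun s => (s, true)) w) = pres_class _ w.
  by rewrite /N big_map pres_classE.
move=> x y; rewrite -(pres_class_repr x) -(pres_class_repr y) !canE.
by move=> /pres_classP/valE; rewrite !n0 !NE !mul1g.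
Qed.

(** Inversion in the group reverses products, which reduces the claim to reversed positive words;
    the relations are stable under reversal. *)
Lemma braid_neg_can_inj :
  injective (@braid_pos_can I adj) -> injective (@braid_neg_can I adj).
Proof.
move=> pos_inj x y; rewrite -(pres_class_repr x) -(pres_class_repr y).
move: (repr x) (repr y) => u v {x y}.
pose rw (w : seq (formal_inv I)) : seq I := rev (map (@formal_inv_val I) w).
have canE w : braid_neg_can (pres_class _ w : braid_monoid_neg adj) =
              (braid_pos_can (pres_class _ (rw w) : braid_monoid_pos adj))^-1.
  rewrite /braid_neg_can /braid_pos_can.
  rewrite (pres_lift_class (@sigma_neg_rel I adj)).
  rewrite (pres_lift_class (@sigma_pos_rel I adj)).
  by rewrite prodgV /rw -map_rev big_map.
rewrite !canE => /invg_inj/pos_inj/pres_classP uv; apply/pres_classP.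
have revE w : w = map (@FormalInv I) (rev (rw w)).
  by rewrite revK -map_comp map_id_in // => -[].
rewrite (revE u) (revE v); move: (rw u) (rw v) uv => {u v revE}.
move=> u v; elim=> {u v} [u v l r R|w|w1 w2 _|w1 w2 w3 _ IH12 _ IH23].
- rewrite !rev_cat !map_cat -!catA; case: R => i j aij.
    by apply: pres_cong_step; constructor.
  (* Reversal exchanges the two sides of a commutation relation. *)
  by apply/pres_cong_sym/pres_cong_step; constructor.
- exact: pres_cong_refl.
- exact: pres_cong_sym.
- exact: pres_cong_trans IH12 IH23.
Qed.
End Embedding.

(** * The ADE diagrams and the conclusion *)

Lemma ade_adj_sym t : symmetric (ade_adj t).
Proof. by move=> i j; rewrite /ade_adj orbC. Qed.

Lemma ade_adj_irr t : ade_valid t -> irreflexive (ade_adj t).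
Proof. by case: t => n /= nv i; rewrite /ade_adj /=; lia. Qed.

Lemma ade_triangle_free t i j k : ade_valid t ->
  ade_adj t i j -> ade_adj t j k -> ade_adj t i k = false.
Proof. by case: t => n /= nv; rewrite /ade_adj /=; lia. Qed.

Lemma ade_central (M : monoidType) (t : ade_type) (h : nat -> M) :
  ade_valid t ->
  (forall i j, i < ade_rank t -> j < ade_rank t -> ade_adj t i j ->
    h i * (h j * h i) = h j * (h i * h j)) ->
  (forall i j, i < ade_rank t -> j < ade_rank t -> ~~ ade_adj t i j ->
    commute (h i) (h j)) ->
  exists D : M, forall i, i < ade_rank t ->
    commute (h i) D /\ exists d, D = h i * d.
Proof.
case: t => n /= nv hbr hco.
- have [|||||||D [[aD bD vD] [aI bI vI]]] :=
    @chain_central M (h 0) (h 0) (fun i => h i.+1) n.-1.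
  + by [].
  + by move=> m0; apply: hbr; rewrite /ade_adj /=; lia.
  + by move=> m0; apply: hbr; rewrite /ade_adj /=; lia.
  + by move=> i im; apply: hco; rewrite /ade_adj /=; lia.
  + by move=> i im; apply: hco; rewrite /ade_adj /=; lia.
  + by move=> i im; apply: hbr; rewrite /ade_adj /=; lia.
  + by move=> i j ij; apply: hco; rewrite /ade_adj /=; lia.
  + by exists D => -[//|i] im; split; [apply: vD|apply: vI]; lia.
(* The fork consists of the vertices [n - 2] and [n - 1], both attached to [n - 3]; the chain runs
   from there down to 0. *)
- have [|||||||D [[aD bD vD] [aI bI vI]]] :=
    @chain_central M (h (n - 2)) (h n.-1) (fun i => h (n - 3 - i)) (n - 2).
  + by apply: hco; rewrite /ade_adj /=; lia.
  + by move=> m0; apply: hbr; rewrite /ade_adj /=; lia.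
  + by move=> m0; apply: hbr; rewrite /ade_adj /=; lia.
  + by move=> i im; apply: hco; rewrite /ade_adj /=; lia.
  + by move=> i im; apply: hco; rewrite /ade_adj /=; lia.
  + by move=> i im; apply: hbr; rewrite /ade_adj /=; lia.
  + by move=> i j ij; apply: hco; rewrite /ade_adj /=; lia.
  + exists D => i im.
    have [->//|i1] := eqVneq i n.-1.
    have [->//|i2] := eqVneq i (n - 2).
    have -> : i = n - 3 - (n - 3 - i) by lia.
    by split; [apply: vD|apply: vI]; lia.
(* The relations are now required for all natural numbers; edges stay below [n], and 1 commutes with
   everything. *)
- pose h' i := if i < n then h i else 1.
  have [||D DP] :=
    @central_wordP (ade_adj (DynE n)) M h' _ _ n _ (central_word_E nv).
  + move=> i j aij; rewrite /h'.
    have [-> ->] : i < n /\ j < n by move: aij; rewrite /ade_adj /=; lia.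
    by apply: hbr => //; move: aij; rewrite /ade_adj /=; lia.
  + move=> i j nij; rewrite /h'.
    case: (ltnP i n) => [ni|_]; last by apply/commute_sym/commute1.
    case: (ltnP j n) => [nj|_]; last exact: commute1.
    exact: hco.
  + by exists D => i im; have := DP i im; rewrite /h' im.
Qed.

Theorem corollary3p3 (I : finType) (adj : rel I) (hADE : ADE_diagram adj) :
  injective (@braid_pos_can I adj) /\ injective (@braid_neg_can I adj).
Proof.
suff pos_inj : injective (@braid_pos_can I adj).
  by split; last apply: braid_neg_can_inj.
case: hADE => t [tv [f [[f' fK f'K] fE]]].
have adjE i j : adj i j = ade_adj t (f' i) (f' j) by rewrite -fE !f'K.
have [D DP] : exists D : braid_monoid_pos adj, forall i,
    commute (sigma_pos adj i) D /\ exists d, D = sigma_pos adj i * d.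
  pose h k : braid_monoid_pos adj := oapp (sigma_pos adj \o f) 1 (insub k).
  have hE (i : 'I_(ade_rank t)) : h i = sigma_pos adj (f i).
    by rewrite /h valK.
  have [||D DP] := @ade_central _ t h tv.
  - move=> i j it jt aij; rewrite (hE (Ordinal it)) (hE (Ordinal jt)).
    have := @sigma_pos_braid _ adj (f (Ordinal it)) (f (Ordinal jt)) 1.
    by rewrite !mulg1; apply; rewrite fE.
  - move=> i j it jt aij; rewrite (hE (Ordinal it)) (hE (Ordinal jt)).
    have := @sigma_pos_comm _ adj (f (Ordinal it)) (f (Ordinal jt)) 1.
    by rewrite !mulg1; apply; rewrite fE.
  by exists D => i; have := DP (f' i) (ltn_ord _); rewrite hE f'K.
apply: (braid_pos_can_inj (D := D)); [|by move=> s; case: (DP s)..].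
apply: pos_cancel => [i|i j|r s u]; rewrite !adjE.
- exact: ade_adj_irr.
- exact: ade_adj_sym.
- exact: ade_triangle_free.
Qed.
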